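(* Let $\mu_k>10$. For any $\varepsilon>0$ there exists $N(\varepsilon,\mu_k)$ such that $$\|I-A_k\mathcal{L}_k\|_{B(\ell^1)}\le\varepsilon\qquad\text{for all even }N>N(\varepsilon,\mu_k).$$ Consequently, for $\varepsilon<1$, $\mathcal{L}_k$ is boundedly invertible on $\ell^1$ with $$\|\mathcal{L}_k^{-1}\|_{B(\ell^1)}\le\frac{C(\mu_k)}{1-\varepsilon},$$ and $A_k\to\mathcal{L}_k^{-1}$ in $B(\ell^1)$ as $\frac N2\to\infty$ ($N$ even).
   Context: $\mu_k$ is a real number. $\ell^1$ is the space of real sequences $y=(y_j)_{j\ge0}$ with $\|y\|_{\ell^1}=|y_0|+2\sum_{j\ge1}|y_j|<\infty$, and $\|\cdot\|_{B(\ell^1)}$ is the induced operator norm. $\mathcal{L}_k$ is given by $(\mathcal{L}_ky)_0=y_0+2\sum_{\ell\ge1}(-1)^\ell y_\ell$ and $(\mathcal{L}_ky)_j=\mu_ky_{j-1}+2j\,y_j-\mu_ky_{j+1}$ for $j\ge1$; $\mathcal{L}_k^{(N)}$ is its $(N+1)\times(N+1)$ upper-left truncation (indices $0,\dots,N$), which is invertible. For even $N$, $A_k=A_k(N)$ is the infinite block matrix $$A_k=\begin{pmatrix}(\mathcal{L}_k^{(N)})^{-1}&-[(\mathcal{L}_k^{(N)})^{-1}]_{col(1)}\,v\,\Omega^{-1}\\0&\Omega^{-1}\end{pmatrix},$$ where $[\cdot]_{col(1)}$ is the first column, $v=(-2,2,-2,2,\dots)$ is an infinite row vector, and $\Omega=\mathrm{diag}(2(N+1),2(N+2),2(N+3),\dots)$;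 the first block corresponds to indices $0,\dots,N$ and the second to indices $\ge N+1$. The product $A_k\mathcal{L}_k$ is the product of the infinite matrices, which defines a bounded operator on $\ell^1$. ''Boundedly invertible'' means that for every $z\in\ell^1$ there is a unique $y\in\ell^1$ with $\mathcal{L}_ky=z$ and $\mathcal{L}_k^{-1}:z\mapsto y$ is bounded. The constant is $C(\mu_k)=1.612+0.1$ for $\mu_k\in(10,100]$, $C(\mu_k)=1.472+0.01$ for $\mu_k\in(100,1000]$, and $C(\mu_k)=1.454+0.001$ for $\mu_k>1000$. *)

(* Defs.v *)
From mathcomp Require Import all_boot all_order all_algebra.
From mathcomp Require Import all_classical all_reals all_analysis.
From mathcomp Require Import zify ring lra.

Set Implicit Arguments.
Unset Strict Implicit.
Unset Printing Implicit Defensive.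

Import Order.TTheory GRing.Theory Num.Theory.
Import numFieldNormedType.Exports.
Local Open Scope classical_set_scope.
Local Open Scope ring_scope.

Definition l1norm (R : realType) (y : nat -> R) : \bar R :=
  (`|y 0%N|%:E + 2%:E * \sum_(1 <= j <oo) `|y j|%:E)%E.

Definition l1 (R : realType) : set (nat -> R) := [set y | (l1norm y < +oo)%E].

(* An operator on l^1 is a map on all sequences of which only the restriction
   to l^1 is meaningful; opnorm is the induced norm. *)
Definition opnorm (R : realType) (T : (nat -> R) -> nat -> R) : \bar R :=
  ereal_sup [set l1norm (T y) | y in [set y | (l1norm y <= 1)%E]].

Definition linear_on_l1 (R : realType) (T : (nat -> R) -> nat -> R) : Prop :=
  forall (a : R) (y z : nat -> R), l1 y -> l1 z ->
    T (fun j => a * y j + z j) = (fun j => a * T y j + T z j).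

Definition bounded_op (R : realType) (T : (nat -> R) -> nat -> R) : Prop :=
  [/\ forall y, l1 y -> l1 (T y), linear_on_l1 T & (opnorm T < +oo)%E].

Definition matop (R : realType) (M : nat -> nat -> R) (y : nat -> R) : nat -> R :=
  fun i => limn (series (fun j => M i j * y j)).

(* The convergence clause is needed because limn has an arbitrary value on
   divergent series. *)
Definition bounded_matrix (R : realType) (M : nat -> nat -> R) : Prop :=
  (forall y, l1 y -> forall i, cvgn (series (fun j => M i j * y j))) /\
  bounded_op (matop M).

Definition matprod (R : realType) (M P : nat -> nat -> R) : nat -> nat -> R :=
  fun i j => limn (series (fun m => M i m * P m j)).

Definition Lop (R : realType) (mu : R) (y : nat -> R) : nat -> R :=
  fun j => if j is j'.+1 then mu * y j' + 2 * j%:R * y j - mu * y j.+1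
           else y 0%N + 2 * limn (fun n => \sum_(1 <= l < n) (-1) ^+ l * y l).

(* The infinite matrix of Lop, see matop_Lmx below.  Its columns are finitely
   supported, so the series in matprod M (Lmx mu) are finite sums. *)
Definition Lmx (R : realType) (mu : R) (i j : nat) : R :=
  if i is i'.+1 then
    if j == i' then mu else if j == i then 2 * i%:R
    else if j == i.+1 then - mu else 0
  else if j == 0%N then 1 else 2 * (-1) ^+ j.

(* Invertible for mu > 0, see Ltrunc_unit below. *)
Definition Ltrunc (R : realType) (mu : R) (N : nat) : 'M[R]_N.+1 :=
  \matrix_(i < N.+1, j < N.+1) Lmx mu i j.

Definition vrow (R : realType) (l : nat) : R := if odd l then 2 else - 2.

Definition Omega (R : realType) (N l : nat) : R := 2 * (N + 1 + l)%:R.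

(* Rows and columns 0..N form the first block; position l of the second block
   is index N + 1 + l. *)
Definition Amx (R : realType) (mu : R) (N : nat) (i j : nat) : R :=
  let LNinv := invmx (Ltrunc mu N) in
  if (i <= N)%N then
    if (j <= N)%N then LNinv (inord i) (inord j)
    else - (LNinv (inord i) ord0 * vrow R (j - N.+1) * (Omega R N (j - N.+1))^-1)
  else if j == i then (Omega R N (j - N.+1))^-1 else 0.

Definition is_bounded_inverse (R : realType) (T S : (nat -> R) -> nat -> R) : Prop :=
  (forall z, l1 z ->
     [/\ l1 (S z), T (S z) = z & forall y, l1 y -> T y = z -> y = S z]) /\
  bounded_op S.

(* Only meaningful for mu > 10. *)
Definition Cmu (R : realType) (mu : R) : R :=
  if mu <= 100 then 1612 / 1000 + 1 / 10
  else if mu <= 1000 then 1472 / 1000 + 1 / 100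
  else 1454 / 1000 + 1 / 1000.

Lemma l1_cvg_series_norm (R : realType) (y : nat -> R) : l1 y ->
  cvgn (series (fun j => `|y j|)).
Proof.
rewrite /l1 /= /l1norm => hy.
have hS : (\sum_(1 <= j <oo) `|y j|%:E < +oo)%E.
  rewrite ltNge leye_eq; apply/negP => /eqP E.
  by move: hy; rewrite E gt0_muley ?lte_fin // addey // ltxx.
have S0 : (0 <= \sum_(1 <= j <oo) `|y j|%:E)%E.
  by apply: nneseries_ge0 => n _ _; rewrite lee_fin.
apply: nondecreasing_is_cvgn.
  by apply/nondecreasing_seqP => n; rewrite /series /= big_nat_recr //= lerDl.
exists (`|y 0%N| + fine (\sum_(1 <= j <oo) `|y j|%:E)) => _ [n _ <-].
rewrite /series /=; case: n => [|n].
  by rewrite big_geq // addr_ge0 // fine_ge0.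
rewrite big_ltn // lerD2l -lee_fin fineK; last by rewrite ge0_fin_numE.
rewrite -sumEFin; apply: nneseries_lim_ge => k _ _.
by rewrite lee_fin.
Qed.

Lemma sum_Lmx_row (R : realType) (mu : R) (y : nat -> R) (i n : nat) :
  (i.+3 <= n)%N ->
  \sum_(0 <= j < n) Lmx mu i.+1 j * y j = Lop mu y i.+1.
Proof.
move=> hn; rewrite (@big_cat_nat _ _ _ i) //=; last by lia.
rewrite (@big_cat_nat _ _ _ i.+3 i n) //=; last by lia.
rewrite [X in X + _]big1_seq ?add0r; last first.
  move=> j; rewrite mem_index_iota => /andP[_ hj].
  by rewrite !ifF ?mul0r //; lia.
rewrite [X in _ + X]big1_seq ?addr0; last first.
  move=> j; rewrite mem_index_iota => /andP[_ hj].
  by rewrite !ifF ?mul0r //; lia.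
rewrite big_ltn; last by lia.
rewrite big_ltn; last by lia.
rewrite big_ltn; last by lia.
rewrite big_geq // addr0 eqxx.
rewrite (_ : (i.+1 == i) = false); last by lia.
rewrite (_ : (i.+2 == i) = false); last by lia.
rewrite (_ : (i.+2 == i.+1) = false); last by lia.
by rewrite !eqxx mulNr addrA.
Qed.

Lemma matop_Lmx (R : realType) (mu : R) (y : nat -> R) : l1 y ->
  (forall i, cvgn (series (fun j => Lmx mu i j * y j))) /\
  matop (Lmx mu) y = Lop mu y.
Proof.
move=> hy; have cy := l1_cvg_series_norm hy.
have row i : series (fun j => Lmx mu i.+1 j * y j) @ \oo --> Lop mu y i.+1.
  apply: cvg_near_cst; exists i.+3 => // n /= hn.
  exact: sum_Lmx_row.
have row0 : cvgn (series (fun l => (-1) ^+ l * y l)).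
  apply: normed_cvg; rewrite (_ : [normed _] = series (fun j => `|y j|)) //; last first.
  by apply/funext => n; apply: eq_bigr => j _ /=; rewrite normrM normrX normrN1 expr1n mul1r.
have shift0 : (fun n => \sum_(1 <= l < n) (-1) ^+ l * y l) @ \oo -->
    limn (series (fun l => (-1) ^+ l * y l)) - y 0%N.
  apply: (@cvg_trans _ ((fun n => series (fun l => (-1) ^+ l * y l) n - y 0%N) @ \oo)).
    apply: near_eq_cvg; exists 1%N => // n /= hn.
    by rewrite /series /= [in LHS]big_ltn // expr0 mul1r addrAC subrr add0r.
  by apply: cvgB => //; exact: cvg_cst.
have row0' : series (fun j => Lmx mu 0 j * y j) @ \oo --> Lop mu y 0.
  rewrite /Lop.
  apply: (@cvg_trans _
    ((fun n => y 0%N + 2 * \sum_(1 <= l < n) (-1) ^+ l * y l) @ \oo)).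
    apply: near_eq_cvg; exists 1%N => // n /= hn.
    rewrite /series /= [in RHS]big_ltn //= mul1r; congr (_ + _).
    rewrite big_distrr /=; apply: eq_big_nat => j /andP[hj _].
    by rewrite ifF ?mulrA //; lia.
  apply: cvgD; first exact: cvg_cst.
  by apply: cvgMr; rewrite (cvg_lim _ shift0).
split; first by case=> [|i]; [exact: (cvgP _ row0')|exact: (cvgP _ (row i))].
by apply/funext => -[|i]; apply: cvg_lim.
Qed.

Lemma matprod_LmxE (R : realType) (mu : R) (M : nat -> nat -> R) (i j : nat) :
  matprod M (Lmx mu) i j = \sum_(0 <= m < j.+2) M i m * Lmx mu m j.
Proof.
apply: cvg_lim => //; apply: cvg_near_cst; exists j.+2 => // n /= hn.
rewrite /series /= (@big_cat_nat _ _ _ j.+2) //= [X in _ + X]big1_seq ?addr0 //.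
case=> [|m]; rewrite mem_index_iota => /andP[_] //= hm.
by rewrite !ifF ?mulr0 //; lia.
Qed.

Lemma Ltrunc_unit (R : realType) (mu : R) (N : nat) : 0 < mu ->
  Ltrunc mu N \in unitmx.
Proof.
move=> mu0; rewrite -unitmx_tr unitmxE unitfE; apply/negP => /det0P[v v0 vL].
pose y j := if (j <= N)%N then v ord0 (inord j) else 0.
have row0 n i : (i <= N)%N -> (N < n)%N -> \sum_(0 <= j < n) Lmx mu i j * y j = 0.
  move=> hi hn; rewrite (@big_cat_nat _ _ _ N.+1) //=.
  rewrite [X in _ + X]big1_seq ?addr0; last first.
    move=> j; rewrite mem_index_iota => /andP[_ hj].
    by rewrite /y ifF ?mulr0 //; lia.
  move/matrixP/(_ ord0 (inord i)): vL; rewrite !mxE => vE; rewrite -[RHS]vE.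
  rewrite big_mkord; apply: eq_bigr => j _.
  by rewrite /y -ltnS ltn_ord !mxE inord_val inordK // mulrC.
pose z j := (-1) ^+ j * y j.
have zrec i : (i < N)%N -> mu * z i = 2 * i.+1%:R * z i.+1 + mu * z i.+2.
  move=> hi; have := @row0 (N + 3)%N i.+1 hi.
  rewrite sum_Lmx_row; last by lia.
  move=> /(_ ltac:(lia)) /= E.
  have -> : mu * z i = (-1) ^+ i * (mu * y i) by rewrite /z; ring.
  have -> : mu * y i = - (2 * i.+1%:R * y i.+1) + mu * y i.+2 by lra.
  by rewrite /z !exprS; ring.
have zN1 : z N.+1 = 0 by rewrite /z /y ltnn mulr0.
have z_ge0 k : (k <= N)%N -> 0 <= z (N - k)%N * z N /\ 0 <= z (N - k).+1 * z N.
  elim: k => [|k IH] hk; first by rewrite subn0 zN1 mul0r -expr2 sqr_ge0.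
  have [|h1 h2] := IH; first by lia.
  have E : (N - k.+1).+1 = (N - k)%N by lia.
  rewrite E; split=> //.
  rewrite -(pmulr_rge0 _ mu0) mulrA zrec; last by lia.
  rewrite E mulrDl; apply: addr_ge0; rewrite -(mulrA _ _ (z N)).
    by apply: (mulr_ge0 _ h1); apply: mulr_ge0.
  by apply: (mulr_ge0 _ h2); exact: ltW.
have sum0 : z 0%N + 2 * \sum_(1 <= j < N.+1) z j = 0.
  rewrite -[RHS](@row0 N.+1 0%N) // [RHS]big_ltn //= mul1r /z expr0 mul1r; congr (_ + _).
  rewrite big_distrr /=; apply: eq_big_nat => j /andP[hj _].
  by rewrite ifF ?mulrA //; lia.
have zz j : (j <= N)%N -> 0 <= z j * z N.
  by move=> hj; have [|+ _] := z_ge0 (N - j)%N; [lia|rewrite subKn].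
have zN : z N = 0.
  have : z 0%N * z N + 2 * \sum_(1 <= j < N.+1) z j * z N = 0.
    by rewrite -big_distrl /= mulrA -mulrDl sum0 mul0r.
  have s0 m : (m <= N.+1)%N -> 0 <= \sum_(1 <= j < m) z j * z N.
    by move=> hm; rewrite big_nat; apply: sumr_ge0 => j hj; apply: zz; lia.
  have h0 := zz 0%N (leq0n N).
  move=> E; suff : z N * z N = 0 by move/eqP; rewrite mulf_eq0 orbb => /eqP.
  case: (posnP N) => hN.
    by move: E; rewrite hN big_geq // mulr0 addr0.
  move: E; rewrite big_nat_recr //= => E.
  have := s0 N (leqnSn N); have := zz N (leqnn N); lra.
have zall k : (k <= N)%N -> z (N - k)%N = 0 /\ z (N - k).+1 = 0.
  elim: k => [|k IH] hk; first by rewrite subn0.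
  have [|h1 h2] := IH; first by lia.
  have E : (N - k.+1).+1 = (N - k)%N by lia.
  rewrite E; split=> //; apply: (mulfI (lt0r_neq0 mu0)).
  by rewrite zrec ?E ?h1 ?h2 ?mulr0 ?addr0 //; lia.
move/eqP: v0; apply; apply/rowP => j; rewrite mxE.
have [|+ _] := zall (N - j)%N; first by lia.
rewrite subKn; last by rewrite -ltnS.
by move/eqP; rewrite mulf_eq0 signr_eq0 /= /y -ltnS ltn_ord inord_val => /eqP.
Qed.

(* Main.v *)
Require Import Defs.
From mathcomp Require Import all_boot all_order all_algebra.
From mathcomp Require Import all_classical all_reals all_analysis.
From mathcomp Require Import zify ring lra.
Import Order.TTheory GRing.Theory Num.Theory.
Import numFieldNormedType.Exports.
Local Open Scope classical_set_scope.
Local Open Scope ring_scope.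

Set Implicit Arguments.
Unset Strict Implicit.

(** Everything rests on one bound that is uniform in [N]: the inverse of the
    truncated operator has norm at most 29/20 on l^1, for every [mu > 0].

    An operator on l^1 has norm [sup_k |column k| / wt k], so it is enough to
    bound columns.  Put [z j = (-1) ^ j * y j] for column [k >= 1] of the
    truncated inverse.  Then [- mu z_(j-1) + 2 j z_j + mu z_(j+1)] vanishes
    except for a sign at [j = k], and [z_0 + 2 sum z_j = 0]; these are the
    cosine coefficients of the solution of [f' + mu sin(t) f = - g] with
    [f(0) = 0] and [g = +- sin(k t)].  Two energy identities are used.
    Let [w_j = z_0 + 2 (z_1 + ... + z_j)], which vanishes from [N] on.
    Multiplying the recurrence by [w_j + w_(j-1)] and summing by parts gives
      [sum w_j^2 + 2 mu sum (z_j + z_(j+1))^2 = -+ (w_k + w_(k-1))],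
    hence [mu sum (z_j + z_(j+1))^2 <= 1/4].  Squaring the recurrence gives
      [4 sum j^2 z_j^2 <= 1 + 4 mu sum z_j z_(j+1) <= 5/4],
    and Cauchy-Schwarz against [sum 1/j^2 <= 5/3] bounds [sum |z_j|]
    ([energy_column]).  Column [0] is a normalised vector of values of one sign
    (truncated Bessel functions), of norm [1] ([l1le_Amx0]).

    Consequently a finitely supported [y] satisfies [|y| <= 29/20 |L y|]
    ([fin_stable]).  Each column [a] of [A] is finitely supported and
    [L a - delta k] is [O(1/N)] ([residual_col]), so for growing [N] these
    columns form a Cauchy sequence.  Their limits are the columns of a matrix
    [Linvmx] of norm at most 29/20, at distance [O(1/N)] from [A], and [Linvmx]
    inverts [L]: on the right because each row of [L] is a continuous functional
    ([Lop_matop_Linvmx]), on the left because [fin_stable] applied to truncations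
    of [y] shows that [L] is injective ([Lop_injective]).  Since
    [29/20 <= Cmu mu], this is the bound on the inverse.

    The matrix [I - A L] has only columns of index [>= N], and they involve
    [mu] times the columns of [A] of index [>= N].  Those beyond [N] are
    [O(1/N)] by their explicit form, and the last column of the truncated
    inverse is [O(1/N)] because of the diagonal entry [2 N] ([colle_defect]). *)

(** * Sequences with bounded weighted sums *)

(** The norm of the [j]-th unit sequence, so that the norm of l^1 is the sum of
    [wt j * |y j|]. *)
Definition wt (R : realType) (j : nat) : R := if j == 0%N then 1 else 2.

(** The relation [l1norm y <= K], see [l1leP], kept on finite real sums so that
    no extended real enters the estimates. *)
Definition l1le (R : realType) (y : nat -> R) (K : R) : Prop :=
  forall n, \sum_(0 <= j < n) wt R j * `|y j| <= K.

Definition delta (R : realType) (k j : nat) : R := (j == k)%:R.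

Section WeightedNorm.
Variable R : realType.
Implicit Types (y z : nat -> R) (K L a : R).

Lemma wt_gt0 j : 0 < wt R j. Proof. by rewrite /wt; case: ifP. Qed.

Lemma wt_ge1 j : 1 <= wt R j.
Proof. by rewrite /wt; case: ifP => // _; rewrite ler1n. Qed.

Lemma wt_le2 j : wt R j <= 2.
Proof. by rewrite /wt; case: ifP => // _; rewrite ler1n. Qed.

Lemma psum_ge0 y n : 0 <= \sum_(0 <= j < n) wt R j * `|y j|.
Proof. by apply: sumr_ge0 => j _; rewrite mulr_ge0 // ltW // wt_gt0. Qed.

Lemma psum_mono y m n : (m <= n)%N ->
  \sum_(0 <= j < m) wt R j * `|y j| <= \sum_(0 <= j < n) wt R j * `|y j|.
Proof.
move=> mn; rewrite (@big_cat_nat _ _ _ m 0 n) //= lerDl.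
by apply: sumr_ge0 => j _; rewrite mulr_ge0 // ltW // wt_gt0.
Qed.

Lemma psumE y n :
  \sum_(0 <= j < n.+1) wt R j * `|y j| = `|y 0%N| + 2 * \sum_(1 <= j < n.+1) `|y j|.
Proof.
rewrite big_ltn // {1}/wt eqxx mul1r big_distrr /=; congr (_ + _).
by apply: eq_big_nat => -[|j].
Qed.

Lemma l1leP y K : (l1norm y <= K%:E)%E <-> l1le y K.
Proof.
have ge0 (j : nat) : (0%R <= `|y j|%:E)%E by rewrite lee_fin.
split=> [yK n|yK].
  rewrite (le_trans (psum_mono y (leqnSn n))) // psumE -lee_fin.
  apply: le_trans yK; rewrite /l1norm EFinD EFinM leeD2l // lee_pmul2l ?lte_fin //.
  rewrite -sumEFin; exact: nneseries_lim_ge.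
have S0 : (\sum_(1 <= j <oo) `|y j|%:E <= ((K - `|y 0%N|) / 2)%:E)%E.
  apply: lime_le; first by apply: is_cvg_nneseries.
  apply: nearW => -[|n]; last first.
    by rewrite sumEFin lee_fin ler_pdivlMr //; have := yK n.+1; rewrite psumE; lra.
  by rewrite big_geq // lee_fin; have := yK 1%N; rewrite psumE big_geq //; lra.
rewrite /l1norm; apply: (@le_trans _ _ (`|y 0%N|%:E + 2%:E * ((K - `|y 0%N|) / 2)%:E)%E).
  by rewrite leeD2l // lee_pmul2l ?lte_fin.
by rewrite -EFinM -EFinD lee_fin; lra.
Qed.

Lemma l1norm_ge0 y : (0 <= l1norm y)%E.
Proof.
rewrite /l1norm adde_ge0 ?lee_fin // mule_ge0 ?lee_fin //.
by apply: nneseries_ge0 => n _ _; rewrite lee_fin.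
Qed.

Lemma l1le_l1 y K : l1le y K -> l1 y.
Proof. by move/l1leP => h; apply: (le_lt_trans h); rewrite ltry. Qed.

Lemma l1P y : l1 y -> exists K, l1le y K.
Proof.
move=> hy; exists (fine (l1norm y)); apply/l1leP; rewrite fineK // ge0_fin_numE //.
exact: l1norm_ge0.
Qed.

Lemma l1le_ge0 y K : l1le y K -> 0 <= K.
Proof. by move/(_ 0%N); rewrite big_geq. Qed.

Lemma l1le_le y K L : l1le y K -> K <= L -> l1le y L.
Proof. by move=> h KL n; apply: le_trans (h n) KL. Qed.

Lemma l1le_eq y z K : y =1 z -> l1le y K -> l1le z K.
Proof. by move=> /funext ->. Qed.

Lemma l1leD y z K L : l1le y K -> l1le z L -> l1le (fun j => y j + z j) (K + L).
Proof.
move=> h1 h2 n; apply: le_trans (lerD (h1 n) (h2 n)); rewrite -big_split /=.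
by apply: ler_sum => j _; rewrite -mulrDr ler_pM2l ?wt_gt0 // ler_normD.
Qed.

Lemma l1leZ a y K : l1le y K -> l1le (fun j => a * y j) (`|a| * K).
Proof.
move=> h n; rewrite (_ : \sum_(_ <= _ < _) _ = `|a| * \sum_(0 <= j < n) wt R j * `|y j|).
  by rewrite ler_wpM2l.
by rewrite big_distrr /=; apply: eq_bigr => j _; rewrite normrM mulrCA.
Qed.

Lemma l1leB y z K L : l1le y K -> l1le z L -> l1le (fun j => y j - z j) (K + L).
Proof.
move=> h1 /(@l1leZ (-1)); rewrite normrN1 mul1r => /(l1leD h1).
by apply: l1le_eq => j; rewrite mulN1r.
Qed.

Lemma l1le0 : l1le (fun=> 0 : R) 0.
Proof. by move=> n; rewrite big1 // => j _; rewrite normr0 mulr0. Qed.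

Lemma l1le_sum m (c : nat -> R) (f : nat -> nat -> R) (C : nat -> R) :
  (forall k, (k < m)%N -> l1le (f k) (C k)) ->
  l1le (fun j => \sum_(0 <= k < m) c k * f k j) (\sum_(0 <= k < m) `|c k| * C k).
Proof.
elim: m => [|m IH] h; first by rewrite big_geq //; apply: l1le_eq l1le0 => j; rewrite big_geq.
rewrite big_nat_recr //=; have := l1leD (IH _) (l1leZ (c m) (h m (ltnSn m))).
move=> /(_ ltac:(by move=> k km; apply: h; lia)); apply: l1le_eq => j.
by rewrite big_nat_recr.
Qed.

Lemma l1le_delta k : l1le (delta R k) (wt R k).
Proof.
move=> n; have [kn|nk] := ltnP k n.
  rewrite (bigD1_seq k) ?mem_index_iota ?iota_uniq //= /delta eqxx normr1 mulr1.
  by rewrite big1 ?addr0 // => j /negbTE ->; rewrite normr0 mulr0.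
rewrite big1_seq ?ltW ?wt_gt0 // => j; rewrite mem_index_iota => /andP[_ hj].
by rewrite /delta (_ : (j == k) = false) ?normr0 ?mulr0 //; lia.
Qed.

Lemma l1le_coord y K j : l1le y K -> `|y j| <= K.
Proof.
move=> h; apply: le_trans (h j.+1); rewrite big_nat_recr //=.
apply: le_trans (_ : _ <= wt R j * `|y j|) _; first by rewrite ler_peMl // wt_ge1.
by rewrite lerDr psum_ge0.
Qed.

Lemma cvg_sum_nat (f : nat -> nat -> R) (g : nat -> R) n :
  (forall j, f ^~ j @ \oo --> g j) ->
  (fun m => \sum_(0 <= j < n) f m j) @ \oo --> \sum_(0 <= j < n) g j.
Proof.
move=> fg; elim: n => [|n IH].
  rewrite big_geq // (_ : (fun _ => _) = cst 0) ?funeqE => [|m]; first exact: cvg_cst.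
  by rewrite big_geq.
rewrite big_nat_recr //= (_ : (fun _ => _) =
  (fun m => \sum_(0 <= j < n) f m j + f m n)); first exact: cvgD.
by apply/funext => m; rewrite big_nat_recr.
Qed.

(** Closed balls of l^1 are closed under pointwise limits, because [l1le] only
    speaks of finite sums. *)
Lemma l1le_lim (f : nat -> nat -> R) y (C : nat -> R) K :
  (forall j, f ^~ j @ \oo --> y j) -> (\forall m \near \oo, l1le (f m) (C m)) ->
  C @ \oo --> K -> l1le y K.
Proof.
move=> fy fC CK n.
have L : (fun m => \sum_(0 <= j < n) wt R j * `|f m j|) @ \oo -->
    \sum_(0 <= j < n) wt R j * `|y j|.
  by apply: cvg_sum_nat => j; apply: cvgMr; apply: cvg_norm; exact: fy.
rewrite -(cvg_lim _ L) // -(cvg_lim _ CK) //; apply: ler_lim.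
- by apply: cvgP L.
- by apply: cvgP CK.
- by near=> m; near: m; apply: filterS fC => m; apply.
Unshelve. all: by end_near. Qed.

Lemma l1le_tail y : l1 y -> forall e, 0 < e -> exists n0, forall n, (n0 <= n)%N ->
  l1le (fun j => if (j < n)%N then 0 else y j) e.
Proof.
move=> /l1P[K hy] e e0.
have c : cvgn (fun n => \sum_(0 <= j < n) wt R j * `|y j|).
  apply: nondecreasing_is_cvgn; first by move=> m n mn; exact: psum_mono.
  by exists K => _ [n _ <-].
have /cvgrPdist_lt/(_ e e0)[n0 _ hn0] := c.
exists n0 => n nn0 m; have [mn|nm] := leqP m n.
  rewrite big1_seq ?ltW // => j; rewrite mem_index_iota => /andP[_ hj].
  by rewrite ifT ?normr0 ?mulr0 //; lia.
rewrite (@big_cat_nat _ _ _ n) ?(ltnW nm) //= [X in X + _]big1_seq ?add0r; last first.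
  move=> j; rewrite mem_index_iota => /andP[_ hj].
  by rewrite ifT ?normr0 ?mulr0 //; lia.
set l := limn _ in hn0; have := hn0 n nn0; rewrite ltr_norml => /andP[_ /ltW].
have : \sum_(0 <= j < m) wt R j * `|y j| <= l.
  by apply: nondecreasing_cvgn_le => // a b ab; exact: psum_mono.
rewrite (@big_cat_nat _ _ _ n 0 m) ?(ltnW nm) //=.
rewrite (_ : \sum_(n <= i < m) wt R i * `|if (i < n)%N then 0 else y i| =
  \sum_(n <= i < m) wt R i * `|y i|); first by lra.
by apply: eq_big_nat => j /andP[hj _]; rewrite ifF //; lia.
Qed.

Lemma opnorm_le (T : (nat -> R) -> nat -> R) K :
  (forall y, l1le y 1 -> l1le (T y) K) -> (opnorm T <= K%:E)%E.
Proof.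
move=> h; apply: ub_ereal_sup => _ [y /= y1 <-].
by apply/l1leP; apply: h; apply/l1leP.
Qed.

End WeightedNorm.

(** * Matrices with bounded columns *)

(** The norm of a matrix acting on l^1 is decided on unit sequences: the [k]-th
    one has norm [wt k] and its image is column [k]. *)
Definition colle (R : realType) (M : nat -> nat -> R) (K : R) : Prop :=
  forall k, l1le (M^~ k) (K * wt R k).

Section Matrices.
Variable R : realType.
Implicit Types (M P : nat -> nat -> R) (y z : nat -> R) (K L a : R).

Lemma colle_ge0 M K : colle M K -> 0 <= K.
Proof. by move/(_ 0%N)/l1le_ge0; rewrite pmulr_lge0 // wt_gt0. Qed.

Lemma matop_cvg M K y : colle M K -> l1 y ->
  forall i, cvgn (series (fun j => M i j * y j)).
Proof.
move=> hM /l1P[L hy] i; apply: normed_cvg.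
rewrite /normed_series_of; apply: nondecreasing_is_cvgn.
  by apply/nondecreasing_seqP => n; rewrite /series /= big_nat_recr //= lerDl.
exists (K * L) => _ [n _ <-]; rewrite /series /=.
apply: (@le_trans _ _ (\sum_(0 <= j < n) K * (wt R j * `|y j|))); last first.
  by rewrite -big_distrr /= ler_wpM2l // (colle_ge0 hM).
apply: ler_sum => j _; rewrite normrM mulrA ler_wpM2r //.
exact: l1le_coord (hM j).
Qed.

Lemma matopP M K y : colle M K -> l1 y -> forall i,
  series (fun j => M i j * y j) @ \oo --> matop M y i.
Proof. by move=> hM hy i; have := matop_cvg hM hy (i := i). Qed.

(** The finite combinations of columns obey the bound by the triangle
    inequality, and the bound passes to the pointwise limit. *)
Lemma l1le_matop M K y L : colle M K -> l1le y L -> l1le (matop M y) (K * L).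
Proof.
move=> hM hy; apply: (@l1le_lim _ (fun m i => series (fun j => M i j * y j) m)
  _ (fun=> K * L)).
- by apply: matopP hM _; exact: l1le_l1 hy.
- apply: nearW => m.
  have := @l1le_sum _ m y (fun k => M^~ k) (fun k => K * wt R k) (fun k _ => hM k).
  have le : \sum_(0 <= k < m) `|y k| * (K * wt R k) <= K * L.
    rewrite (_ : \sum_(_ <= _ < _) _ = K * \sum_(0 <= k < m) wt R k * `|y k|).
      by rewrite ler_wpM2l ?(colle_ge0 hM).
    by rewrite big_distrr /=; apply: eq_bigr => k _; rewrite mulrCA [X in K * X]mulrC.
  move=> h; apply: l1le_le le; apply: l1le_eq h => i.
  by rewrite /series /=; apply: eq_bigr => k _; rewrite mulrC.
- exact: cvg_cst.
Qed.

Lemma matop_lin M a y z i :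
  cvgn (series (fun j => M i j * y j)) -> cvgn (series (fun j => M i j * z j)) ->
  matop M (fun j => a * y j + z j) i = a * matop M y i + matop M z i.
Proof.
move=> cy cz; apply: cvg_lim => //.
rewrite (_ : series _ = (fun n => a * series (fun j => M i j * y j) n +
   series (fun j => M i j * z j) n)).
  by apply: cvgD => //; apply: cvgMr.
apply/funext => n; rewrite /series /= big_distrr -big_split /=.
by apply: eq_bigr => j _; rewrite mulrDr mulrCA.
Qed.

Lemma matopB M P K L y : colle M K -> colle P L -> l1 y -> forall i,
  matop (fun i j => M i j - P i j) y i = matop M y i - matop P y i.
Proof.
move=> hM hP hy i; apply: cvg_lim => //.
rewrite (_ : series _ = (fun n => series (fun j => M i j * y j) n -
   series (fun j => P i j * y j) n)).
  by apply: cvgB; [exact: matopP hM hy i|exact: matopP hP hy i].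
apply/funext => n; rewrite /series /= -sumrB.
by apply: eq_bigr => j _; rewrite mulrBl.
Qed.

Lemma matop_delta y i : matop (fun i j => delta R j i) y i = y i.
Proof.
apply: cvg_lim => //; apply: cvg_near_cst; exists i.+1 => // n /= hn.
rewrite /series /= (bigD1_seq i) ?mem_index_iota ?iota_uniq //= /delta eqxx mul1r.
by rewrite big1 ?addr0 // => j; rewrite eq_sym => /negbTE ->; rewrite mul0r.
Qed.

Lemma colle_delta : colle (fun i j => delta R j i) 1.
Proof. by move=> k; rewrite mul1r; exact: l1le_delta. Qed.

Lemma l1_lin a y z : l1 y -> l1 z -> l1 (fun j => a * y j + z j).
Proof. by move=> /l1P[K hy] /l1P[L hz]; apply: l1le_l1 (l1leD (l1leZ a hy) hz). Qed.

Lemma colle_opnorm M K : colle M K -> (opnorm (matop M) <= K%:E)%E.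
Proof.
by move=> hM; apply: opnorm_le => y /(l1le_matop hM); rewrite mulr1.
Qed.

Lemma colle_bounded M K : colle M K -> bounded_matrix M.
Proof.
move=> hM; split; first by move=> y; exact: matop_cvg hM.
split.
- by move=> y /l1P[L /(l1le_matop hM)]; exact: l1le_l1.
- move=> a y z hy hz; apply/funext => i.
  by apply: matop_lin; exact: matop_cvg hM _ _.
- by apply: (le_lt_trans (colle_opnorm hM)); rewrite ltry.
Qed.

Lemma matop_fin M y n : (forall j, (n <= j)%N -> y j = 0) -> forall i,
  series (fun j => M i j * y j) @ \oo --> \sum_(0 <= k < n) M i k * y k.
Proof.
move=> y0 i; apply: cvg_near_cst; exists n => // m /= nm.
rewrite /series /= (@big_cat_nat _ _ _ n) //= [X in _ + X]big1_seq ?addr0 // => j.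
by rewrite mem_index_iota => /andP[_ hj]; rewrite y0 ?mulr0 //; lia.
Qed.

(** Only the columns summed up to [n] matter up to [e]: the rest is the image
    of a tail of [y].  This lets the unbounded operator [L] be applied to
    [matop M y] column by column. *)
Lemma matop_tail M K y : colle M K -> l1 y -> forall e, 0 < e ->
  exists n0, forall n, (n0 <= n)%N ->
  l1le (fun i => matop M y i - \sum_(0 <= k < n) y k * M i k) e.
Proof.
move=> hM hy e e0; have K0 := colle_ge0 hM.
have eK : 0 < e / (K + 1) by rewrite divr_gt0 //; lra.
have [n0 h] := l1le_tail hy eK; exists n0 => n nn0.
have := l1le_matop hM (h n nn0) => /(@l1le_le _ _ _ e).
move=> /(_ ltac:(by rewrite mulrA ler_pdivrMr; nra)); apply: l1le_eq => i.
pose g j := if (j < n)%N then y j else 0.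
have hg : series (fun j => M i j * g j) @ \oo --> \sum_(0 <= k < n) M i k * g k.
  by apply: matop_fin => j hj; rewrite /g ifF //; lia.
rewrite (_ : (fun j => if _ then _ else _) = (fun j => -1 * g j + y j)); last first.
  by apply/funext => j; rewrite /g; case: ifP => _; lra.
rewrite matop_lin; last 2 first.
- by apply: cvgP hg.
- by apply: matop_cvg hM hy i.
rewrite {1}/matop (cvg_lim _ hg) // mulN1r addrC; congr (_ - _).
by apply: eq_big_nat => k /andP[_ hk]; rewrite /g hk mulrC.
Qed.

End Matrices.

(** * The operator on summable sequences *)

Section LopOnL1.
Variables (R : realType) (mu : R).
Implicit Types (y z : nat -> R) (K a : R).

Lemma fin_l1 N y : (forall j, (N <= j)%N -> y j = 0) -> l1 y.
Proof.
move=> y0; apply: (@l1le_l1 _ _ (\sum_(0 <= j < N) wt R j * `|y j|)) => n.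
apply: le_trans (psum_mono y (leq_maxl n N)) _.
rewrite (@big_cat_nat _ _ _ N 0 (maxn n N)) ?leq_maxr //= [X in _ + X]big1_seq ?addr0 // => j.
by rewrite mem_index_iota => /andP[_ hj]; rewrite y0 ?normr0 ?mulr0 //; lia.
Qed.

Lemma delta_l1 k : l1 (delta R k).
Proof. exact: l1le_l1 (l1le_delta R k). Qed.

Lemma Lop_lin a y z : l1 y -> l1 z ->
  Lop mu (fun j => a * y j + z j) = (fun j => a * Lop mu y j + Lop mu z j).
Proof.
move=> hy hz; have [cy <-] := matop_Lmx mu hy; have [cz <-] := matop_Lmx mu hz.
have [_ <-] := matop_Lmx mu (l1_lin a hy hz).
by apply/funext => i; rewrite matop_lin.
Qed.

Lemma LopB y z : l1 y -> l1 z ->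
  Lop mu (fun j => y j - z j) = (fun j => Lop mu y j - Lop mu z j).
Proof.
move=> hy hz; rewrite (_ : (fun j => y j - z j) = (fun j => -1 * z j + y j)).
  by rewrite Lop_lin //; apply/funext => j; rewrite mulN1r addrC.
by apply/funext => j; rewrite mulN1r addrC.
Qed.

Lemma Lop_fin N y : (forall j, (N <= j)%N -> y j = 0) -> forall i,
  Lop mu y i = \sum_(0 <= k < N) Lmx mu i k * y k.
Proof.
move=> y0 i; have [_ <-] := matop_Lmx mu (fin_l1 y0).
by apply: cvg_lim => //; exact: matop_fin.
Qed.

Lemma Lop_delta k i : Lop mu (delta R k) i = Lmx mu i k.
Proof.
rewrite (@Lop_fin k.+1) => [|j hj]; last by rewrite /delta (_ : (j == k) = false) //; lia.
rewrite big_nat_recr //= /delta eqxx mulr1 big1_seq ?add0r // => j.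
rewrite mem_index_iota => /andP[_ hj].
by rewrite (_ : (j == k) = false) ?mulr0 //; lia.
Qed.

(** [Lop mu] is unbounded, but each of its rows is a bounded functional. *)
Lemma Lop_coord_le y K i : l1le y K ->
  `|Lop mu y i| <= (2 * `|mu| + 2 * i%:R + 1) * K.
Proof.
move=> hy; have K0 := l1le_ge0 hy; have c j := l1le_coord j hy.
case: i => [|i].
  have [cv <-] := matop_Lmx mu (l1le_l1 hy).
  have : `|matop (Lmx mu) y 0| <= K.
    rewrite -(@cvg_lim _ _ _ _ _ _ _ (cvg_norm (cv 0%N))) //.
    apply: limr_le; first by apply: is_cvg_norm; exact: cv.
    apply: nearW => n; apply: le_trans (hy n); rewrite /series /=.
    apply: (le_trans (ler_norm_sum _ _ _)); apply: ler_sum => j _.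
    rewrite normrM ler_wpM2r // /wt; case: eqP => _; first by rewrite normr1.
    by rewrite normrM normrX normrN1 expr1n mulr1 ger0_norm.
  by move=> h; apply: (le_trans h); rewrite ler_peMl //; have := normr_ge0 mu; lra.
rewrite /Lop; apply: (le_trans (ler_normB _ _)).
apply: (@le_trans _ _ (`|mu| * K + 2 * i.+1%:R * K + `|mu| * K)); last by lra.
apply: lerD; last by rewrite normrM ler_wpM2l.
apply: (le_trans (ler_normD _ _)); rewrite !normrM.
rewrite [`|2|]ger0_norm // [`|_%:R|]ger0_norm //.
by apply: lerD; rewrite ler_wpM2l // mulr_ge0.
Qed.

Lemma Lop_cvg (f : nat -> nat -> R) y i : (forall m, l1 (f m)) -> l1 y ->
  (forall e, 0 < e -> \forall m \near \oo, l1le (fun j => y j - f m j) e) ->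
  (fun m => Lop mu (f m) i) @ \oo --> Lop mu y i.
Proof.
move=> hf hy hC; apply/cvgrPdist_le => e e0.
set D := 2 * `|mu| + 2 * i%:R + 1.
have D0 : 0 < D by rewrite /D; have := normr_ge0 mu; have : 0 <= i%:R :> R by []; lra.
apply: filterS (hC _ (divr_gt0 e0 D0)) => m h.
have -> : Lop mu y i - Lop mu (f m) i = Lop mu (fun j => y j - f m j) i by rewrite LopB.
by apply: (le_trans (Lop_coord_le i h)); rewrite -/D mulrC -ler_pdivlMr.
Qed.

End LopOnL1.

(** * Energy estimate for the truncated recurrence *)

Section Energy.
Variables (R : realType) (mu : R) (mu_gt0 : 0 < mu).
Implicit Types (z w : nat -> R).

(** The multiplier [w j.+1 + w j] is chosen because
    [2 * z j.+1 = w j.+1 - w j] makes the diagonal term a difference of squares,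
    while the increments of [w j.+1 + w j] are [2 * (z j.+1 + z j.+2)], so that
    summation by parts turns the off-diagonal terms into a sum of squares.  The
    boundary terms vanish when [w n = w n.+1 = 0]. *)
Lemma energy_tail_sums z w :
  w 0%N = z 0%N -> (forall j, w j.+1 = w j + 2 * z j.+1) -> forall n,
  \sum_(0 <= j < n) (- mu * z j + 2 * j.+1%:R * z j.+1 + mu * z j.+2) * (w j.+1 + w j)
  = n%:R * w n ^+ 2 - \sum_(0 <= j < n) w j ^+ 2
    + mu * ((z n + z n.+1) * (w n.+1 + w n))
    - 2 * mu * \sum_(0 <= j < n.+1) (z j + z j.+1) ^+ 2.
Proof.
move=> w0 wS; elim=> [|n IH].
  by rewrite !big_nat_recr //= !big_geq // !wS w0; ring.
rewrite big_nat_recr //= {}IH [in RHS]big_nat_recr //= [in RHS](big_nat_recr n.+1) //=.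
by rewrite !wS -[n.+1%:R]natr1; ring.
Qed.

(** The cross terms [4 * mu * j.+1 * z j.+1 * (z j.+2 - z j)] telescope up to
    the products [z j * z j.+1]. *)
Lemma energy_square z n :
  \sum_(0 <= j < n) (- mu * z j + 2 * j.+1%:R * z j.+1 + mu * z j.+2) ^+ 2
  = 4 * \sum_(0 <= j < n) (j.+1%:R * z j.+1) ^+ 2
    + mu ^+ 2 * \sum_(0 <= j < n) (z j.+2 - z j) ^+ 2
    + 4 * mu * (n%:R * (z n * z n.+1) - \sum_(0 <= j < n) z j * z j.+1).
Proof.
elim: n => [|n IH]; first by rewrite !big_geq //; ring.
by rewrite !big_nat_recr //= {}IH -[n.+1%:R]natr1; ring.
Qed.

Lemma sum_inv_square n : \sum_(0 <= j < n) (j.+1%:R ^+ 2)^-1 <= 5 / 3 :> R.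
Proof.
(* The remainder [2 / (2 m + 3)] telescopes: 1/j^2 <= 1/(j-1/2) - 1/(j+1/2). *)
have S m : \sum_(0 <= j < m.+1) (j.+1%:R ^+ 2)^-1 <= 5 / 3 - 2 / (2 * m%:R + 3) :> R.
  elim: m => [|m IH]; first by rewrite big_nat1 expr1n invr1 mulr0 add0r; lra.
  rewrite big_nat_recr //=; apply: (le_trans (lerD IH (lexx _))).
  rewrite -[m.+2%:R]natr1 -[m.+1%:R]natr1; set x := m%:R : R.
  have x0 : 0 <= x by rewrite /x.
  have H : 1 / (x + 1 + 1) ^+ 2 <= 2 / (2 * x + 3) - 2 / (2 * (x + 1) + 3).
    have -> : 2 / (2 * x + 3) - 2 / (2 * (x + 1) + 3) = 4 / ((2 * x + 3) * (2 * x + 5)).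
      by field; apply/andP; split; lra.
    have D0 : 0 < (2 * x + 3) * (2 * x + 5) by apply: mulr_gt0; lra.
    rewrite ler_pdivrMr; last by rewrite exprn_gt0 //; lra.
    by rewrite mulrAC ler_pdivlMr //; lra.
  by move: H; rewrite div1r; lra.
case: n => [|n]; first by rewrite big_geq //; lra.
apply: (le_trans (S n)); have : 0 <= 2 / (2 * n%:R + 3) :> R by rewrite divr_ge0 // addr_ge0.
by lra.
Qed.

(** A column [k.+1] of the truncated inverse has norm at most [29/10], whatever
    [mu] is.  The first identity bounds [mu * sum (z j + z j.+1) ^ 2] by [1/4],
    and this is what the indefinite term of the second one needs, as
    [4 * z j * z j.+1 <= (z j + z j.+1) ^ 2]. *)
Lemma energy_column z N k r : (k < N)%N -> r ^+ 2 = 1 ->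
  (forall j, (N < j)%N -> z j = 0) ->
  z 0%N + 2 * \sum_(0 <= j < N) z j.+1 = 0 ->
  (forall j, (j < N)%N ->
     - mu * z j + 2 * j.+1%:R * z j.+1 + mu * z j.+2 = if j == k then r else 0) ->
  `|z 0%N| + 2 * \sum_(0 <= j < N) `|z j.+1| <= 29 / 10.
Proof.
move=> kN r1 z0 zsum zrec.
pose w n := z 0%N + 2 * \sum_(0 <= j < n) z j.+1.
have w0 : w 0%N = z 0%N by rewrite /w big_geq // mulr0 addr0.
have wS j : w j.+1 = w j + 2 * z j.+1 by rewrite /w big_nat_recr //= mulrDr addrA.
have wN : w N = 0 by [].
have wN1 : w N.+1 = 0 by rewrite wS wN (z0 N.+1) // mulr0 addr0.
have rhs (F : nat -> R -> R) : (forall j, F j 0 = 0) ->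
  \sum_(0 <= j < N) F j (- mu * z j + 2 * j.+1%:R * z j.+1 + mu * z j.+2) = F k r.
  move=> F0; rewrite (bigD1_seq k) ?mem_index_iota ?iota_uniq //= zrec // eqxx.
  rewrite big1_seq ?addr0 // => j /andP[/negbTE jk].
  by rewrite mem_index_iota => /andP[_ jN]; rewrite zrec // jk F0.
have := energy_tail_sums w0 wS N.
rewrite (rhs (fun j x => x * (w j.+1 + w j))) => [E1|j]; last by rewrite mul0r.
have := energy_square z N.
rewrite (rhs (fun j x => x ^+ 2)) => [E2|j]; last by rewrite expr0n.
have zN1 : z N.+1 = 0 by exact: z0.
move: E1 E2; rewrite wN wN1 zN1 r1.
set W := \sum_(0 <= j < N) w j ^+ 2; set U := \sum_(0 <= j < N.+1) _.
set X := \sum_(0 <= j < N) (j.+1%:R * z j.+1) ^+ 2.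
set V := \sum_(0 <= j < N) (z j.+2 - z j) ^+ 2; set Z := \sum_(0 <= j < N) z j * z j.+1.
move=> E1 E2.
have hW : w k ^+ 2 + w k.+1 ^+ 2 <= W.
  rewrite /W (@big_cat_nat _ _ _ k.+1) //= big_nat_recr //=.
  have h1 : 0 <= \sum_(0 <= j < k) w j ^+ 2 by apply: sumr_ge0 => j _; rewrite sqr_ge0.
  suff h2 : w k.+1 ^+ 2 <= \sum_(k.+1 <= j < N) w j ^+ 2 by lra.
  have [k1N|k1N] := ltnP k.+1 N.
    by rewrite big_ltn //= lerDl; apply: sumr_ge0 => j _; rewrite sqr_ge0.
  have -> : k.+1 = N by lia.
  by rewrite wN big_geq // expr0n.
have muU : mu * U <= 1 / 4.
  (* Two completed squares: - r * x - x ^+ 2 <= r ^+ 2 / 4 = 1 / 4. *)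
  have := sqr_ge0 (w k + r / 2); have := sqr_ge0 (w k.+1 + r / 2); nra.
have ZU : 4 * Z <= U.
  rewrite /U big_nat_recr //= /Z big_distrr /=.
  have : 0 <= (z N + z N.+1) ^+ 2 by rewrite sqr_ge0.
  have : \sum_(0 <= j < N) 4 * (z j * z j.+1) <= \sum_(0 <= j < N) (z j + z j.+1) ^+ 2.
    by apply: ler_sum => j _; have := sqr_ge0 (z j - z j.+1); nra.
  lra.
have V0 : 0 <= V by apply: sumr_ge0 => j _; rewrite sqr_ge0.
have hX : X <= 5 / 16.
  have : mu * (4 * Z) <= mu * U by rewrite ler_pM2l.
  have : 0 <= mu ^+ 2 * V by rewrite mulr_ge0 // sqr_ge0.
  nra.
have hS : \sum_(0 <= j < N) `|z j.+1| <= 29 / 40.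
  have := sum_inv_square N; set Q := \sum_(0 <= j < N) _ => hQ.
  (* Young's inequality with a weight 7/3 close to the optimum sqrt (16/3). *)
  suff : \sum_(0 <= j < N) `|z j.+1| <= 7 / 6 * X + 3 / 14 * Q by lra.
  rewrite /X /Q !big_distrr -big_split /=; apply: ler_sum => j _.
  set x := j.+1%:R; have x0 : 0 < x :> R by rewrite ltr0n.
  have xV : x * x^-1 = 1 by rewrite mulfV // lt0r_neq0.
  have -> : (x * z j.+1) ^+ 2 = (x * `|z j.+1|) ^+ 2.
    by rewrite !exprMn -normrX ger0_norm ?sqr_ge0.
  rewrite -exprVn; have := sqr_ge0 (7 * (x * `|z j.+1|) - 3 * x^-1).
  have : (x * `|z j.+1|) * x^-1 = `|z j.+1| by rewrite mulrAC xV mul1r.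
  move: (x * `|z j.+1|) => p; move: (x^-1) => q; move: (`|z j.+1|) => a <-.
  move=> h; rewrite -subr_ge0.
  have -> : 7 / 6 * p ^+ 2 + 3 / 14 * q ^+ 2 - p * q = (7 * p - 3 * q) ^+ 2 / 42 by field.
  by rewrite divr_ge0.
have : `|z 0%N| <= 2 * \sum_(0 <= j < N) `|z j.+1|.
  have -> : z 0%N = - (2 * \sum_(0 <= j < N) z j.+1) by lra.
  by rewrite normrN normrM ger0_norm // ler_pM2l // ler_norm_sum.
lra.
Qed.

End Energy.

(** * Columns of the truncated inverse *)

Section Twist.
Variables (R : realType) (mu : R).
Implicit Types (y z : nat -> R).

Lemma psum_fin N y K : (forall j, (N < j)%N -> y j = 0) ->
  `|y 0%N| + 2 * \sum_(0 <= j < N) `|y j.+1| <= K -> l1le y K.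
Proof.
move=> y0 hK n; apply: le_trans hK.
apply: le_trans (psum_mono y (leq_maxl n N.+1)) _.
rewrite (@big_cat_nat _ _ _ N.+1 0) ?leq_maxr //= psumE.
rewrite [in X in X + _](@big_add1 _ _ _ 0) /= [X in _ + X]big1_seq ?addr0 // => j.
by rewrite mem_index_iota => /andP[_ hj]; rewrite y0 ?normr0 ?mulr0 //; lia.
Qed.

(** Twisting by signs makes row [0] a plain sum and gives the recurrence of the
    modified Bessel functions. *)
Definition twist y j : R := (-1) ^+ j * y j.

Lemma row0_twist y N : \sum_(0 <= m < N.+1) Lmx mu 0 m * y m =
  twist y 0 + 2 * \sum_(0 <= j < N) twist y j.+1.
Proof.
rewrite big_nat_recl //= /twist expr0 !mul1r big_distrr /=; congr (_ + _).
by apply: eq_bigr => j _; rewrite mulrA.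
Qed.

Lemma norm_twist y j : `|twist y j| = `|y j|.
Proof. by rewrite /twist normrM normrX normrN1 expr1n mul1r. Qed.

Lemma Lop_twist y j : (-1) ^+ j.+1 * Lop mu y j.+1 =
  - mu * twist y j + 2 * j.+1%:R * twist y j.+1 + mu * twist y j.+2.
Proof. by rewrite /twist /= !exprS; ring. Qed.

Lemma Amx_lower N i k : (k <= N)%N -> (N < i)%N -> Amx mu N i k = 0.
Proof.
move=> kN Ni; rewrite /Amx leqNgt Ni /= (_ : (k == i) = false) //; lia.
Qed.

End Twist.

Section Columns.
Variables (R : realType) (mu : R) (mu_gt0 : 0 < mu).
Implicit Types (y z : nat -> R).

(** Run downwards from [N], the recurrence [mu * z j = 2 * j.+1 * z j.+1 +
    mu * z j.+2] only adds nonnegative quantities. *)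
Lemma backward_nonneg z N : z N.+1 = 0 -> 0 <= z N ->
  (forall j, (j < N)%N -> - mu * z j + 2 * j.+1%:R * z j.+1 + mu * z j.+2 = 0) ->
  forall j, (j <= N)%N -> 0 <= z j.
Proof.
move=> zN1 zN zrec.
have H m : (m <= N)%N -> 0 <= z (N - m)%N /\ 0 <= z (N - m).+1.
  elim: m => [|m IH] mN; first by rewrite subn0 zN1.
  have [|h1 h2] := IH; first by lia.
  have E : (N - m.+1).+1 = (N - m)%N by lia.
  rewrite E; split=> //; rewrite -(pmulr_rge0 _ mu_gt0).
  have := zrec (N - m.+1)%N; rewrite E => /(_ ltac:(lia)) ?.
  have -> : mu * z (N - m.+1)%N = 2 * (N - m)%:R * z (N - m)%N + mu * z (N - m).+1 by lra.
  by rewrite addr_ge0 // mulr_ge0 // ltW.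
by move=> j jN; have [|+ _] := H (N - j)%N; [lia|rewrite subKn].
Qed.

Lemma Lmx_Amx N i k : (i <= N)%N -> (k <= N)%N ->
  \sum_(0 <= m < N.+1) Lmx mu i m * Amx mu N m k = delta R k i.
Proof.
move=> iN kN; have /matrixP/(_ (inord i) (inord k)) := mulmxV (Ltrunc_unit N mu_gt0).
rewrite !mxE /delta -val_eqE /= !inordK // => <-; rewrite big_mkord.
apply: eq_bigr => m _; rewrite !mxE inordK // /Amx kN.
by rewrite -ltnS ltn_ord inord_val.
Qed.

Lemma Amx_Lmx N i k : (k <= N)%N ->
  \sum_(0 <= m < N.+1) Amx mu N i m * Lmx mu m k = delta R k i.
Proof.
move=> kN; have [iN|Ni] := leqP i N; last first.
  rewrite /delta (_ : (i == k) = false); last by lia.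
  rewrite big1_seq // => m; rewrite mem_index_iota => /andP[_ hm].
  by rewrite Amx_lower ?mul0r.
have /matrixP/(_ (inord i) (inord k)) := mulVmx (Ltrunc_unit N mu_gt0).
rewrite !mxE /delta -val_eqE /= !inordK // => <-; rewrite big_mkord.
apply: eq_bigr => m _; rewrite !mxE inordK // /Amx iN.
by rewrite -ltnS ltn_ord inord_val.
Qed.

(** A left column, extended by zero, satisfies every equation of the infinite
    system except the one of index [N.+1], whose subdiagonal entry sees the last
    entry of the column. *)
Lemma Lop_Amx N k i : (k <= N)%N ->
  Lop mu (Amx mu N ^~ k) i = delta R k i + mu * Amx mu N N k * delta R N.+1 i.
Proof.
move=> kN; have [iN|Ni] := leqP i N.
  rewrite (@Lop_fin _ _ N.+1) => [|j hj]; last by rewrite Amx_lower.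
  by rewrite Lmx_Amx // [delta R N.+1 i]/delta (_ : (i == N.+1) = false) ?mulr0 ?addr0 //; lia.
case: i Ni => // i Ni; rewrite /Lop (Amx_lower mu kN Ni) (Amx_lower mu kN (leqW Ni)).
rewrite /delta (_ : (i.+1 == k) = false); last by lia.
rewrite eqSS add0r !mulr0 addr0 subr0; case: eqP => [->|/eqP iN]; first by rewrite mulr1.
by rewrite Amx_lower ?mulr0 //; lia.
Qed.

(** The entries of the twisted column have one sign, so its norm is the absolute
    value of its weighted sum, which row [0] fixes to be [1]. *)
Lemma l1le_Amx0 N : l1le (Amx mu N ^~ 0%N) 1.
Proof.
pose z := twist (Amx mu N ^~ 0%N).
have zN1 : z N.+1 = 0 by rewrite /z /twist Amx_lower ?mulr0.
have zrec j : (j < N)%N -> - mu * z j + 2 * j.+1%:R * z j.+1 + mu * z j.+2 = 0.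
  move=> jN; rewrite -Lop_twist Lop_Amx // /delta (_ : (j.+1 == N.+1) = false); last by lia.
  by rewrite mulr0 addr0 mulr0.
have zsum : z 0%N + 2 * \sum_(0 <= j < N) z j.+1 = 1.
  by rewrite -(row0_twist mu) Lmx_Amx.
apply: (@psum_fin _ N) => [j hj|]; first exact: Amx_lower.
have zE j : `|Amx mu N j 0%N| = `|z j| by rewrite norm_twist.
rewrite zE; under eq_bigr do rewrite zE.
have [zN|zN] := leP 0 (z N).
  have z0 := backward_nonneg zN1 zN zrec.
  rewrite -[leRHS]zsum ger0_norm ?z0 // lerD2l ler_pM2l // !big_nat.
  by apply: ler_sum => j /andP[_ jN]; rewrite ger0_norm // z0.
have z0 : forall j, (j <= N)%N -> 0 <= - z j.
  apply: (@backward_nonneg (fun j => - z j)) => [||j /zrec].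
  - by rewrite zN1 oppr0.
  - by rewrite oppr_ge0 ltW.
  - by lra.
have : z 0%N + 2 * \sum_(0 <= j < N) z j.+1 <= 0.
  have h0 := z0 0%N (leq0n N).
  suff : \sum_(0 <= j < N) z j.+1 <= 0 by lra.
  rewrite big_nat; apply: sumr_le0 => j /andP[_ jN].
  by rewrite -oppr_ge0 z0.
by rewrite zsum ler10.
Qed.

Lemma l1le_Amx_left N k : (k <= N)%N -> l1le (Amx mu N ^~ k) (29 / 20 * wt R k).
Proof.
case: k => [|k] kN; first by apply: l1le_le (l1le_Amx0 N) _; rewrite /wt /=; lra.
rewrite /wt /= (_ : 29 / 20 * 2 = 29 / 10); last by field.
pose z := twist (Amx mu N ^~ k.+1).
apply: (@psum_fin _ N) => [j hj|]; first exact: Amx_lower.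
have zE j : `|Amx mu N j k.+1| = `|z j| by rewrite norm_twist.
rewrite zE; under eq_bigr do rewrite zE.
apply: (energy_column mu_gt0 (r := (-1) ^+ k.+1) kN).
- by rewrite -exprM mulnC exprM sqrrN expr1n expr1n.
- by move=> j hj; rewrite /z /twist Amx_lower ?mulr0.
- by rewrite -(row0_twist mu) Lmx_Amx.
- move=> j jN; rewrite -Lop_twist Lop_Amx // /delta (_ : (j.+1 == N.+1) = false); last by lia.
  by rewrite mulr0 addr0 eqSS; case: eqP => [->|_]; rewrite ?mulr1 ?mulr0.
Qed.

(** [y] is the combination of the columns of the truncated inverse with
    coefficients [Lop mu y]. *)
Lemma fin_stable N y : (forall j, (N < j)%N -> y j = 0) -> forall K,
  l1le (Lop mu y) K -> l1le y (29 / 20 * K).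
Proof.
move=> y0 K hK.
have := @l1le_sum _ N.+1 (Lop mu y) (fun k => Amx mu N ^~ k)
  (fun k => 29 / 20 * wt R k) (fun k => @l1le_Amx_left N k).
have le : \sum_(0 <= k < N.+1) `|Lop mu y k| * (29 / 20 * wt R k) <= 29 / 20 * K.
  rewrite (_ : \sum_(_ <= _ < _) _ = 29 / 20 * \sum_(0 <= k < N.+1) wt R k * `|Lop mu y k|).
    by rewrite ler_pM2l ?hK // divr_gt0.
  by rewrite big_distrr /=; apply: eq_bigr => k _; rewrite mulrCA [X in _ * X]mulrC.
move=> /l1le_le /(_ le); apply: l1le_eq => i.
have [iN|Ni] := leqP i N; last first.
  rewrite y0 // big1_seq // => k; rewrite mem_index_iota => /andP[_ hk].
  by rewrite Amx_lower ?mulr0.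
transitivity (\sum_(0 <= k < N.+1) \sum_(0 <= j < N.+1) Amx mu N i k * Lmx mu k j * y j).
  apply: eq_big_nat => k _; rewrite (@Lop_fin _ _ N.+1) // mulrC big_distrr /=.
  by apply: eq_bigr => j _; rewrite mulrA.
rewrite exchange_big_nat /= (eq_big_nat _ _ (F2 := fun j => delta R j i * y j)); last first.
  by move=> j /andP[_ jN]; rewrite -big_distrl /= Amx_Lmx.
rewrite (bigD1_seq i) ?mem_index_iota ?iota_uniq //= /delta eqxx mul1r big1 ?addr0 // => j.
by rewrite eq_sym => /negbTE ->; rewrite mul0r.
Qed.

End Columns.

(** * Residuals of the columns of the approximate inverse *)

Section Entries.
Variables (R : realType) (mu : R).

(** The blocks of [Amx] are chosen so that, for [k > N],
    [2 k a_k + 2 (-1)^k a_0 = delta k]: in [A L], the diagonal entry and the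
    entry of row [0] of column [k] of [L] then combine exactly to [delta k]. *)
Lemma Amx_right N k i : ~~ odd N -> (N < k)%N ->
  Amx mu N i k = (2 * k%:R)^-1 * (delta R k i - 2 * (-1) ^+ k * Amx mu N i 0).
Proof.
move=> oN Nk; rewrite /Amx /Omega (_ : N + 1 + (k - N.+1) = k)%N; last by lia.
rewrite /delta [i == k]eq_sym; have [iN|Ni] := leqP i N.
  rewrite leqNgt Nk /= (_ : (k == i) = false); last by lia.
  rewrite /vrow oddB // /= (negbTE oN) addbT -signr_odd (_ : inord 0 = ord0); last first.
    by apply/val_inj; rewrite /= inordK.
  by case: (odd k); rewrite /= ?expr0 ?expr1; ring.
rewrite /= (_ : (0 == i)%N = false); last by lia.
by rewrite mulr0 subr0; case: eqP => _; rewrite ?mulr1 ?mulr0.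
Qed.

Lemma Lmx_colS k i : Lmx mu i k.+1 = 2 * (-1) ^+ k.+1 * delta R 0 i
  + 2 * k.+1%:R * delta R k.+1 i + mu * delta R k.+2 i - mu * (k != 0%N)%:R * delta R k i.
Proof.
rewrite /Lmx /delta; case: i => [|i] /=.
  by case: k => [|k] /=; ring.
rewrite !eqSS [i == k.+1]eq_sym [i == k]eq_sym [i.+1 == k]eq_sym.
have e1 n : (n == n.+1) = false by lia.
have e2 n : (n == n.+2) = false by lia.
case: (k.+1 =P i) => [<-|_]; first by rewrite e1 e2 /=; ring.
case: (k =P i) => [<-|_]; first by rewrite e1 /=; ring.
by case: (k =P i.+1) => [->|_] /=; ring.
Qed.

Lemma sum_delta n k (f : nat -> R) : (k < n)%N ->
  \sum_(0 <= m < n) f m * delta R k m = f k.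
Proof.
move=> kn; rewrite (bigD1_seq k) ?mem_index_iota ?iota_uniq //= /delta eqxx mulr1.
by rewrite big1 ?addr0 // => j /negbTE ->; rewrite mulr0.
Qed.

Lemma mul_Lmx_colS (a : R) m k : a * Lmx mu m k.+1 =
  2 * (-1) ^+ k.+1 * (a * delta R 0 m) + 2 * k.+1%:R * (a * delta R k.+1 m)
  + mu * (a * delta R k.+2 m) - mu * (k != 0%N)%:R * (a * delta R k m).
Proof. by rewrite Lmx_colS; ring. Qed.

Lemma sum_Lmx_col (f : nat -> R) n k : (k.+2 < n)%N ->
  \sum_(0 <= m < n) f m * Lmx mu m k.+1 = 2 * (-1) ^+ k.+1 * f 0%N
   + 2 * k.+1%:R * f k.+1 + mu * f k.+2 - mu * (k != 0%N)%:R * f k.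
Proof.
move=> kn; under eq_bigr do rewrite mul_Lmx_colS.
by rewrite sumrB !big_split -!big_distrr /= !sum_delta //; lia.
Qed.

End Entries.

Section Residuals.
Variables (R : realType) (mu : R) (mu_gt0 : 0 < mu).
Implicit Types (y z : nat -> R).

Lemma l1le_Amx_right N k : ~~ odd N -> (N < k)%N ->
  l1le (Amx mu N ^~ k) (2 / k%:R).
Proof.
case: k => // k oN Nk.
have := l1leZ (2 * k.+1%:R)^-1 (l1leB (l1le_delta R k.+1)
  (l1leZ (2 * (-1) ^+ k.+1) (l1le_Amx0 mu_gt0 N))).
rewrite normrM [`|(-1) ^+ _|]normrX normrN1 expr1n !mulr1 /wt /=.
rewrite [`|2|]ger0_norm // ger0_norm ?invr_ge0 //.
rewrite (_ : _ * (2 + 2) = 2 / k.+1%:R).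
  by apply: l1le_eq => i; rewrite -Amx_right.
by field; rewrite nat1r pnatr_eq0.
Qed.

Lemma colle_Amx N : ~~ odd N -> colle (Amx mu N) (29 / 20).
Proof.
move=> oN k; have [kN|Nk] := leqP k N; first exact: l1le_Amx_left.
apply: (l1le_le (l1le_Amx_right oN Nk)); case: k Nk => // k _; rewrite /wt /=.
rewrite ler_pdivrMr ?ltr0n //; have : 1 <= k.+1%:R :> R by rewrite ler1n.
lra.
Qed.

(** Row [N] of the system has diagonal [2 * N], so the last entry is of order
    [1/N] as soon as the column is bounded. *)
Lemma last_entry_le N k : (k <= N)%N ->
  N.+1%:R * `|Amx mu N N k| <= (2 + 2 * mu) * wt R k.
Proof.
move=> kN; have c j := l1le_coord j (l1le_Amx_left mu_gt0 kN).
have w1 := wt_ge1 R k.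
case: N kN c => [|N] kN c.
  rewrite mul1r; apply: (le_trans (c 0%N)); apply: ler_wpM2r; [lra|have := mu_gt0; lra].
have := Lop_Amx mu_gt0 N.+1 kN; rewrite /Lop (Amx_lower mu kN (leqnn N.+2)).
rewrite [delta R N.+2 _]/delta (_ : (N.+1 == N.+2) = false) ?mulr0 ?subr0 ?addr0; last by lia.
move=> E.
have h : `|2 * N.+1%:R * Amx mu N.+1 N.+1 k| <= 1 + mu * (29 / 20 * wt R k).
  have -> : 2 * N.+1%:R * Amx mu N.+1 N.+1 k = delta R k N.+1 - mu * Amx mu N.+1 N k by lra.
  apply: (le_trans (ler_normB _ _)); apply: lerD.
    by rewrite /delta; case: eqP => _; rewrite ?normr1 ?normr0.
  by rewrite normrM gtr0_norm // ler_pM2l // c.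
rewrite normrM ger0_norm // in h.
have : N.+2%:R * `|Amx mu N.+1 N.+1 k| <= 2 * N.+1%:R * `|Amx mu N.+1 N.+1 k|.
  by rewrite ler_wpM2r // -natrM ler_nat; lia.
have : 0 <= mu * wt R k by rewrite mulr_ge0 // ltW // wt_gt0.
lra.
Qed.

(** For [k <= N] the residual comes from the last entry of the column, for
    [k > N] from the off-diagonal entries of [Lmx mu] and the residual of
    column [0], both divided by [2 * k]. *)
Lemma residual_col N k : ~~ odd N ->
  l1le (fun i => Lop mu (Amx mu N ^~ k) i - delta R k i)
       (4 * mu * (1 + mu) / N.+1%:R * wt R k).
Proof.
move=> oN; have w1 := wt_ge1 R k; have N0 : 0 < N.+1%:R :> R by rewrite ltr0n.
have mu0 := ltW mu_gt0.
have [kN|Nk] := leqP k N.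
  have := l1leZ (mu * Amx mu N N k) (l1le_delta R N.+1).
  rewrite (_ : wt R N.+1 = 2) // normrM gtr0_norm // => h; apply: l1le_le (l1le_eq _ h) _.
    by move=> i; rewrite Lop_Amx // addrAC subrr add0r.
  rewrite [leRHS]mulrAC ler_pdivlMr //.
  by have := last_entry_le kN; rewrite -(ler_pM2l mu_gt0); lra.
case: k Nk w1 => // k Nk w1.
have cN := l1le_coord N (l1le_Amx0 mu_gt0 N).
have h : l1le (fun i => mu * delta R k.+2 i - mu * (k != 0%N)%:R * delta R k i
    - 2 * (-1) ^+ k.+1 * (mu * Amx mu N N 0) * delta R N.+1 i) (8 * mu).
  have := l1leB (l1leB (l1leZ mu (l1le_delta R k.+2))
     (l1leZ (mu * (k != 0%N)%:R) (l1le_delta R k)))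
     (l1leZ (2 * (-1) ^+ k.+1 * (mu * Amx mu N N 0)) (l1le_delta R N.+1)).
  move/l1le_le; apply; rewrite !normrM normrX normrN1 expr1n gtr0_norm //.
  rewrite [`|2|]ger0_norm // /wt /=.
  by case: (k) => [|k'] /=; rewrite ?normr0 ?normr1; nra.
have k0 : 0 <= (2 * k.+1%:R)^-1 :> R by rewrite invr_ge0.
apply: l1le_le (l1le_eq _ (l1leZ (2 * k.+1%:R)^-1 h)) _ => [i|].
  rewrite (_ : (Amx mu N)^~ k.+1 = fun i => (- (2 * (-1) ^+ k.+1) * (2 * k.+1%:R)^-1) *
    Amx mu N i 0 + (2 * k.+1%:R)^-1 * delta R k.+1 i + 0); last first.
    by apply/funext => j; rewrite Amx_right //; ring.
  rewrite (_ : (fun i => _ + _ + _) = (fun i => (- (2 * (-1) ^+ k.+1) * (2 * k.+1%:R)^-1) *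
    Amx mu N i 0 + ((2 * k.+1%:R)^-1 * delta R k.+1 i + 0))); last first.
    by apply/funext => j; rewrite addrA.
  have z1 : l1 (fun=> 0 : R) := l1le_l1 (l1le0 R).
  have L0 j : Lop mu (fun=> 0) j = 0.
    by rewrite (@Lop_fin _ _ 0%N) ?big_geq.
  rewrite Lop_lin; [|exact: l1le_l1 (l1le_Amx0 mu_gt0 N)|exact/l1_lin/z1/delta_l1].
  rewrite Lop_lin; [|exact: delta_l1|exact: z1].
  rewrite L0 Lop_delta Lmx_colS Lop_Amx // addr0.
  by field; rewrite nat1r pnatr_eq0.
rewrite (ger0_norm k0).
have -> : (2 * k.+1%:R)^-1 * (8 * mu) = 4 * mu / k.+1%:R by field; rewrite nat1r pnatr_eq0.
apply: (@le_trans _ _ (4 * mu / N.+1%:R)).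
  by rewrite ler_pM2l ?mulr_gt0 // lef_pV2 ?posrE ?ltr0n // ler_nat.
have -> : 4 * mu * (1 + mu) / N.+1%:R * wt R k.+1 =
  4 * mu / N.+1%:R * ((1 + mu) * wt R k.+1) by ring.
rewrite ler_peMr //; first by rewrite divr_ge0 // mulr_ge0.
by nra.
Qed.

End Residuals.

(** * The defect I - A L *)

Section Defect.
Variables (R : realType) (mu : R) (mu_gt0 : 0 < mu).
Implicit Types (y z : nat -> R).

(** Column [N] of [A L = I] on the first block reads
    [2 N a_N = delta N - 2 (-1)^N a_0 + mu a_(N-1)], and the right-hand side is
    bounded. *)
Lemma Amx_last_col_le N : ~~ odd N -> (0 < N)%N ->
  l1le (Amx mu N ^~ N) ((4 + 3 * mu) / N.+1%:R).
Proof.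
case: N => // N oN _; have w2 := wt_le2 R N; have w1 := wt_ge1 R N.
have := l1leZ (2 * N.+1%:R)^-1 (l1leD (l1leB (l1le_delta R N.+1)
  (l1leZ (2 * (-1) ^+ N.+1) (l1le_Amx0 mu_gt0 N.+1)))
  (l1leZ (mu * (N != 0%N)%:R) (l1le_Amx_left mu_gt0 (leqnSn N)))).
move=> h; apply: l1le_le (l1le_eq _ h) _ => [i|].
  have := Amx_Lmx mu_gt0 i (leqnn N.+1).
  have -> : \sum_(0 <= m < N.+2) Amx mu N.+1 i m * Lmx mu m N.+1 =
     2 * (-1) ^+ N.+1 * Amx mu N.+1 i 0 + 2 * N.+1%:R * Amx mu N.+1 i N.+1
     - mu * (N != 0%N)%:R * Amx mu N.+1 i N.
    have := sum_Lmx_col mu (Amx mu N.+1 i) (ltnSn N.+2).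
    rewrite big_nat_recr //= {2}/Lmx eqxx; lra.
  move=> <-; set x := N.+1%:R; have x0 : x != 0 :> R by rewrite pnatr_eq0.
  by field.
have -> : `|(2 * N.+1%:R)^-1| = (2 * N.+1%:R)^-1 :> R.
  by rewrite ger0_norm // invr_ge0.
have -> : `|2 * (-1) ^+ N.+1| = 2 :> R.
  by rewrite normrM normrX normrN1 expr1n mulr1 ger0_norm.
have e3 : `|mu * (N != 0%N)%:R| <= mu.
  rewrite normrM gtr0_norm // ler_piMr ?(ltW mu_gt0) //.
  by case: (N != 0%N); rewrite ?normr1 ?normr0.
apply: (@le_trans _ _ ((2 * N.+1%:R)^-1 * (4 + 3 * mu))).
  rewrite ler_pM2l ?invr_gt0 ?mulr_gt0 ?ltr0n // (_ : wt R N.+1 = 2) //.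
  have : `|mu * (N != 0%N)%:R| * (29 / 20 * wt R N) <= mu * (29 / 20 * 2).
    by apply: ler_pM => //; [rewrite mulr_ge0 ?ltW ?wt_gt0|lra].
  by have := mu_gt0; lra.
rewrite [leLHS]mulrC ler_pM2l; last by have := mu_gt0; lra.
by rewrite lef_pV2 ?posrE ?mulr_gt0 ?ltr0n // -natrM ler_nat; lia.
Qed.

(** The first block cancels exactly; the coupling between the blocks shows only
    in column [N]. *)
Lemma matprod_Amx_Lmx_left N i k : (k <= N)%N ->
  matprod (Amx mu N) (Lmx mu) i k =
  delta R k i + if k == N then mu * Amx mu N i N.+1 else 0.
Proof.
move=> kN; rewrite matprod_LmxE.
have := Amx_Lmx mu_gt0 i kN; case: eqP => [->|/eqP kN'].
  by move=> E; rewrite big_nat_recr //= E /Lmx eqxx mulrC.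
move=> <-; rewrite addr0 (@big_cat_nat _ _ _ k.+2 0 N.+1) //=; last by lia.
rewrite [X in _ + X]big1_seq ?addr0 // => -[|m]; rewrite mem_index_iota => /andP[_] //= hm.
by rewrite !ifF ?mulr0 //; lia.
Qed.

Lemma matprod_Amx_Lmx_right N i k : ~~ odd N -> (N <= k)%N ->
  matprod (Amx mu N) (Lmx mu) i k.+1 =
  delta R k.+1 i + mu * (Amx mu N i k.+2 - (k != 0%N)%:R * Amx mu N i k).
Proof.
move=> oN Nk; rewrite matprod_LmxE sum_Lmx_col // (@Amx_right _ mu N k.+1) //.
by field; rewrite nat1r pnatr_eq0.
Qed.

Lemma colle_defect N : ~~ odd N -> (0 < N)%N ->
  colle (fun i k => delta R k i - matprod (Amx mu N) (Lmx mu) i k)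
        (mu * (6 + 3 * mu) / N.+1%:R).
Proof.
move=> oN N0 k; have mu0 := ltW mu_gt0.
have NS : 0 < N.+1%:R :> R by rewrite ltr0n.
have bound C : C <= 6 + 3 * mu -> mu * (C / N.+1%:R) <= mu * (6 + 3 * mu) / N.+1%:R * wt R k.
  move=> hC; have w1 := wt_ge1 R k.
  apply: (@le_trans _ _ (mu * (6 + 3 * mu) / N.+1%:R)).
    by rewrite -mulrA ler_pM2l // ler_pM2r ?invr_gt0.
  by rewrite ler_peMr // divr_ge0 // mulr_ge0 //; lra.
have inv m : (N < m)%N -> 2 / m%:R <= 2 / N.+1%:R :> R.
  by move=> Nm; rewrite ler_pM2l // lef_pV2 ?posrE ?ltr0n ?ler_nat //; lia.
have [kN|Nk] := leqP k N.
  have h : l1le (Amx mu N ^~ N.+1) (2 / N.+1%:R) by exact: l1le_Amx_right.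
  have := l1leZ (- mu * (k == N)%:R) h => /l1le_le/(_ (_ : _ <= _)).
  move=> /(_ (mu * (6 + 3 * mu) / N.+1%:R * wt R k)) g; apply: (l1le_eq _ (g _)).
    by move=> i; rewrite matprod_Amx_Lmx_left //; case: eqP => _ /=; ring.
  have le2 : 2 <= 6 + 3 * mu by lra.
  apply: le_trans (bound 2 le2).
  rewrite normrM normrN (gtr0_norm mu_gt0). rewrite -mulrA ler_pM2l //.
  have := divr_ge0 (ler0n R 2) (ltW NS).
  by case: eqP => _; rewrite ?normr1 ?normr0 ?mul1r ?mul0r.
case: k Nk bound => // k Nk bound.
have h2 : l1le (Amx mu N ^~ k.+2) (2 / N.+1%:R).
  by apply: (l1le_le (l1le_Amx_right mu_gt0 oN _)); [lia|apply: inv; lia].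
have h0 : l1le (Amx mu N ^~ k) ((4 + 3 * mu) / N.+1%:R).
  move: Nk; rewrite ltnS leq_eqVlt => /orP[/eqP <-|Nk]; first exact: Amx_last_col_le.
  apply: (l1le_le (l1le_Amx_right mu_gt0 oN Nk)); apply: (le_trans (inv _ Nk)).
  by rewrite ler_pM2r ?invr_gt0 //; lra.
have := l1leZ (- mu) (l1leB h2 (l1leZ (k != 0%N)%:R h0)) => h.
apply: l1le_le (l1le_eq _ h) _ => [i|].
  by rewrite matprod_Amx_Lmx_right //; ring.
apply: le_trans (bound (6 + 3 * mu) (lexx _)).
rewrite normrN gtr0_norm // ler_pM2l //.
have -> : (6 + 3 * mu) / N.+1%:R = 2 / N.+1%:R + (4 + 3 * mu) / N.+1%:R by ring.
rewrite lerD2l ler_piMl // ?divr_ge0 ?(ltW NS) //; first by lra.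
by case: (k != 0%N); rewrite ?normr1 ?normr0.
Qed.

End Defect.

(** * The inverse as a limit of matrices *)

Lemma cvgn_rate (R : realType) (f c : nat -> R) : c @ \oo --> 0 ->
  (forall m n, `|f m - f n| <= c m + c n) -> cvgn f.
Proof.
move=> c0 fc; apply/cauchy_cvgP; apply: cauchy_exP => e e0.
have e20 : 0 < e / 2 by rewrite divr_gt0.
have /cvgrPdist_lt/(_ (e / 2) e20)[M _ hM] := c0.
exists (f M); exists M => // n /= Mn; apply: (le_lt_trans (fc M n)).
have := hM M (leqnn M); have := hM n Mn; rewrite /= !sub0r !normrN => h1 h2.
by have := ler_norm (c M); have := ler_norm (c n); lra.
Qed.

Section Inverse.
Variables (R : realType) (mu : R) (mu_gt0 : 0 < mu).
Implicit Types (y z : nat -> R).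

(** The stability constant [29/20] times the bound of [residual_col] for the
    size [m.*2], with [m.*2.+1] replaced by [m.+1]. *)
Definition rate (m : nat) : R := 29 / 20 * (4 * mu * (1 + mu)) / m.+1%:R.

Lemma rate_cvg0 : rate @ \oo --> 0.
Proof.
rewrite -(mulr0 (29 / 20 * (4 * mu * (1 + mu)))).
by apply: cvgMr; exact: cvg_harmonic.
Qed.

Lemma Amx_support N i k : (N < i)%N -> (k < i)%N -> Amx mu N i k = 0.
Proof.
by move=> Ni ki; rewrite /Amx leqNgt Ni /= (_ : (k == i) = false) //; lia.
Qed.

Lemma Amx_l1 N k : l1 (Amx mu N ^~ k).
Proof.
by apply: (@fin_l1 _ (maxn N k).+1) => j; rewrite gtn_max => /andP[]; exact: Amx_support.
Qed.

(** The difference of two approximations of a column is finitely supported, and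
    the operator maps it to a difference of residuals. *)
Lemma Amx_cauchy m n k :
  l1le (fun i => Amx mu m.*2 i k - Amx mu n.*2 i k) ((rate m + rate n) * wt R k).
Proof.
pose c j : R := 4 * mu * (1 + mu) / j.+1%:R * wt R k.
have res j : l1le (fun i => Lop mu (Amx mu j.*2 ^~ k) i - delta R k i) (c j).
  apply: l1le_le (residual_col mu_gt0 k _) _; first by rewrite odd_double.
  rewrite /c ler_pM2r ?wt_gt0 // ler_pM2l; last by rewrite !mulr_gt0 // ?addr_gt0.
  by rewrite lef_pV2 ?posrE ?ltr0n // ler_nat; lia.
have -> : (rate m + rate n) * wt R k = 29 / 20 * (c m + c n).
  by rewrite /rate /c; ring.
apply: (fin_stable mu_gt0 (N := maxn (maxn m.*2 n.*2) k)).
  move=> j; rewrite !gtn_max => /andP[/andP[h1 h2] h3].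
  by rewrite !Amx_support // subr0.
rewrite LopB; [|exact: Amx_l1..].
by apply: l1le_eq (l1leB (res m) (res n)) => i; ring.
Qed.

Definition Linvmx (i k : nat) : R := limn (fun m => Amx mu m.*2 i k).

Lemma Linvmx_cvg i k : (fun m => Amx mu m.*2 i k) @ \oo --> Linvmx i k.
Proof.
suff : cvgn (fun m => Amx mu m.*2 i k) by [].
apply: (@cvgn_rate _ _ (fun m => rate m * wt R k)).
  by rewrite -(mul0r (wt R k)); apply: cvgMl; exact: rate_cvg0.
by move=> m n; rewrite -mulrDl; exact: l1le_coord (Amx_cauchy m n k).
Qed.

Lemma colle_Amx_sub_Linvmx m : colle (fun i k => Amx mu m.*2 i k - Linvmx i k) (rate m).
Proof.
move=> k; apply: (@l1le_lim _ (fun n i => Amx mu m.*2 i k - Amx mu n.*2 i k) _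
  (fun n => (rate m + rate n) * wt R k)).
- by move=> i; apply: cvgB; [exact: cvg_cst|exact: Linvmx_cvg].
- by apply: nearW => n; exact: Amx_cauchy.
- apply: cvgMl; rewrite -[X in _ --> X]addr0; apply: cvgD; first exact: cvg_cst.
  exact: rate_cvg0.
Qed.

Lemma colle_Linvmx : colle Linvmx (29 / 20).
Proof.
move=> k; apply: (@l1le_lim _ (fun n i => Amx mu n.*2 i k) _ (fun=> 29 / 20 * wt R k)).
- by move=> i; exact: Linvmx_cvg.
- by apply: nearW => n; apply: colle_Amx => //; rewrite odd_double.
- exact: cvg_cst.
Qed.

Lemma rate_small k e : 0 < e -> \forall m \near \oo, rate m * wt R k <= e.
Proof.
move=> e0; have : (fun m => rate m * wt R k) @ \oo --> 0.
  by rewrite -(mul0r (wt R k)); apply: cvgMl; exact: rate_cvg0.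
move=> /cvgrPdist_le/(_ e e0); apply: filterS => m; rewrite sub0r normrN.
exact: le_trans (ler_norm _).
Qed.

(** The images [Lop mu] of the approximate columns converge rowwise both to the
    image of the limit and, by the residual bound, to [delta k]. *)
Lemma Lop_Linvmx k i : Lop mu (Linvmx ^~ k) i = delta R k i.
Proof.
have c1 : (fun m => Lop mu (Amx mu m.*2 ^~ k) i) @ \oo --> Lop mu (Linvmx ^~ k) i.
  apply: Lop_cvg => [m||e e0]; [exact: Amx_l1|exact: l1le_l1 (colle_Linvmx k)|].
  apply: filterS (rate_small k e0) => m h; have := l1le_le (colle_Amx_sub_Linvmx m k) h.
  by move/(l1leZ (-1)); rewrite normrN1 mul1r; apply: l1le_eq => j; ring.
have c2 : (fun m => Lop mu (Amx mu m.*2 ^~ k) i) @ \oo --> delta R k i.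
  apply/cvgrPdist_le => e e0; apply: filterS (rate_small k e0) => m; apply: le_trans.
  have om : ~~ odd m.*2 by rewrite odd_double.
  have := l1le_coord i (residual_col mu_gt0 k om); rewrite distrC => /le_trans; apply.
  rewrite /rate ler_pM2r ?wt_gt0 //.
  have h : 0 < 4 * mu * (1 + mu) by rewrite !mulr_gt0 // addr_gt0.
  apply: (@le_trans _ _ (4 * mu * (1 + mu) / m.+1%:R)).
    by rewrite ler_pM2l // lef_pV2 ?posrE ?ltr0n // ler_nat; lia.
  by rewrite ler_pM2r ?invr_gt0 ?ltr0n //; lra.
by rewrite -(cvg_lim _ c1) // (cvg_lim _ c2).
Qed.

Lemma Lop_sum n (c : nat -> R) (M : nat -> nat -> R) : (forall k, l1 (M^~ k)) ->
  l1 (fun i => \sum_(0 <= k < n) c k * M i k) /\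
  Lop mu (fun i => \sum_(0 <= k < n) c k * M i k) =
  (fun i => \sum_(0 <= k < n) c k * Lop mu (M^~ k) i).
Proof.
move=> hM; elim: n => [|n [IH1 IH2]].
  have E (F : nat -> nat -> R) : (fun i => \sum_(0 <= k < 0) F i k) = (fun=> 0 : R).
    by move=> *; apply/funext => i; rewrite big_geq.
  rewrite !E; split; first exact: l1le_l1 (l1le0 R).
  by apply/funext => i; rewrite (@Lop_fin _ _ 0%N) ?big_geq.
have E (F : nat -> nat -> R) : (fun i => \sum_(0 <= k < n.+1) c k * F i k) =
    (fun i => c n * F i n + \sum_(0 <= k < n) c k * F i k :> R).
  by apply/funext => i; rewrite big_nat_recr //= addrC.
rewrite E (E (fun i k => Lop mu (M^~ k) i)); split; first exact: l1_lin.
by rewrite Lop_lin // IH2.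
Qed.

Lemma Lop_matop_Linvmx z : l1 z -> Lop mu (matop Linvmx z) = z.
Proof.
move=> hz; have [K hK] := l1P hz; apply/funext => i.
have hB k : l1 (Linvmx^~ k) by exact: l1le_l1 (colle_Linvmx k).
have c1 : (fun n => Lop mu (fun j => \sum_(0 <= k < n) z k * Linvmx j k) i) @ \oo -->
    Lop mu (matop Linvmx z) i.
  apply: Lop_cvg => [n||e e0].
  - by have [] := Lop_sum n z hB.
  - exact: l1le_l1 (l1le_matop colle_Linvmx hK).
  - by have [n0 h] := matop_tail colle_Linvmx hz e0; exists n0.
rewrite -(cvg_lim _ c1) //; apply: cvg_lim => //; apply: cvg_near_cst.
exists i.+1 => // n /= hn; have [_ ->] := Lop_sum n z hB.
under eq_bigr do rewrite Lop_Linvmx.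
rewrite (bigD1_seq i) ?mem_index_iota ?iota_uniq //= /delta eqxx mulr1.
by rewrite big1 ?addr0 // => k; rewrite eq_sym => /negbTE ->; rewrite mulr0.
Qed.

(** For [y] in the kernel, the operator maps a truncation [h] of [y] to
    something supported in [{0, n, n+1}] that is controlled by the tail of [y];
    stability then makes [h] itself arbitrarily small. *)
Lemma Lop_injective y : l1 y -> Lop mu y = (fun=> 0) -> y = (fun=> 0).
Proof.
move=> hy Ly0; apply/funext => i; apply/eqP; rewrite -normr_le0; apply/ler_addgt0Pl => e e0.
set D := 29 / 20 * (6 * mu + 1).
have D0 : 0 < D by rewrite /D mulr_gt0 // addr_gt0 ?mulr_gt0.
have e'0 := divr_gt0 e0 D0; set e' := e / D in e'0.
have [n0 hn0] := l1le_tail hy e'0.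
pose n := (maxn n0 i).+1; pose h j := if (j < n.+1)%N then y j else 0.
pose t j := if (j < n.+1)%N then 0 else y j.
have ht : l1le t e' by apply: hn0; rewrite /n; lia.
have hl : l1 h by apply: (@fin_l1 _ n.+1) => j hj; rewrite /h ifF //; lia.
have ynS : `|y n.+1| <= e'.
  by have := l1le_coord n.+1 ht; rewrite /t ltnn.
have yn : `|y n| <= e'.
  have n0n : (n0 <= n)%N by rewrite /n; lia.
  by have := l1le_coord n (hn0 n n0n); rewrite ltnn.
have Lh0 : `|Lop mu h 0| <= (2 * mu + 1) * e'.
  have -> : Lop mu h 0 = - Lop mu t 0.
    have -> : h = (fun j => y j - t j).
      by apply/funext => j; rewrite /h /t; case: ifP => _; lra.
    by rewrite LopB ?Ly0 ?sub0r //; exact: l1le_l1 ht.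
  have := Lop_coord_le mu 0 ht.
  by rewrite normrN mulr0 addr0 (gtr0_norm mu_gt0); apply.
have Lh : Lop mu h =1 (fun j => Lop mu h 0 * delta R 0 j + mu * y n.+1 * delta R n j
    + mu * y n * delta R n.+1 j).
  case=> [|j].
    by rewrite /delta eqxx (_ : (0 == n)%N = false) // (_ : (0 == n.+1)%N = false) //=; ring.
  have := congr1 (fun f => f j.+1) Ly0; rewrite /Lop /= => E.
  rewrite /delta /= eqSS /h.
  case: (ltngtP j.+1 n) => [jn|nj|jn].
  - rewrite !ifT; [|lia..].
    by rewrite E (_ : (j == n) = false) /=; [ring|lia].
  - rewrite (_ : (j.+2 < n.+1)%N = false); last by lia.
    rewrite (_ : (j.+1 < n.+1)%N = false); last by lia.
    case: (eqVneq j n) => [->|jn]; first by rewrite ltnSn /=; ring.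
    by rewrite ifF; [rewrite /=; ring|lia].
  - rewrite (_ : (j < n.+1)%N); last by lia.
    rewrite (_ : (j.+1 < n.+1)%N); last by lia.
    rewrite (_ : (j.+2 < n.+1)%N = false); last by lia.
    rewrite (_ : (j == n) = false); last by lia.
    by rewrite -jn /=; lra.
have bound : l1le (Lop mu h) ((6 * mu + 1) * e').
  have := l1leD (l1leD (l1leZ (Lop mu h 0) (l1le_delta R 0))
    (l1leZ (mu * y n.+1) (l1le_delta R n))) (l1leZ (mu * y n) (l1le_delta R n.+1)).
  move=> g; apply: l1le_le (l1le_eq (fsym Lh) g) _.
  rewrite !normrM (gtr0_norm mu_gt0) /wt /= mulr1.
  have h1 : mu * `|y n.+1| <= mu * e' by rewrite ler_pM2l.
  have h2 : mu * `|y n| <= mu * e' by rewrite ler_pM2l.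
  lra.
have := l1le_coord i (fin_stable mu_gt0 (N := n) _ bound); rewrite /h ifT; last by rewrite /n; lia.
have -> : 29 / 20 * ((6 * mu + 1) * e') = e.
  by rewrite mulrA -/D /e' mulrC divfK // lt0r_neq0.
by rewrite addr0; apply => j hj; rewrite ifF //; lia.
Qed.

End Inverse.

(** * The theorem *)

Lemma Cmu_ge (R : realType) (mu : R) : 29 / 20 <= Cmu mu.
Proof. by rewrite /Cmu; case: ifP => _; [|case: ifP => _]; lra. Qed.

Theorem theorem3p28 (R : realType) (mu : R) (hmu : 10 < mu) :
  (forall eps : R, 0 < eps ->
     exists N0 : nat, forall N : nat, ~~ odd N -> (N0 < N)%N ->
       bounded_matrix (matprod (Amx mu N) (Lmx mu)) /\
       (opnorm (fun y j => (y j - matop (matprod (Amx mu N) (Lmx mu)) y j)%R)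
          <= eps%:E)%E) /\
  (exists Linv : (nat -> R) -> nat -> R,
     [/\ is_bounded_inverse (Lop mu) Linv,
         forall eps : R, 0 < eps -> eps < 1 ->
           (opnorm Linv <= (Cmu mu / (1 - eps))%:E)%E,
         forall m : nat, bounded_matrix (Amx mu m.*2) &
         (fun m : nat => opnorm (fun y j => (matop (Amx mu m.*2) y j - Linv y j)%R))
           @ \oo --> 0%E]).
Proof.
have mu_gt0 : 0 < mu by lra.
have oA m : ~~ odd m.*2 by rewrite odd_double.
split=> [eps eps0|].
  exists (Num.bound (mu * (6 + 3 * mu) / eps)) => N oN NN.
  have N0 : (0 < N)%N by lia.
  have hE := colle_defect mu_gt0 oN N0.
  set P := matprod _ _ in hE *; set eta := (X in colle _ X) in hE.
  have hP : colle P (1 + eta).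
    move=> k; rewrite mulrDl; apply: l1le_eq (l1leB (colle_delta R k) (hE k)) => i.
    by rewrite subKr.
  have eta_eps : eta <= eps.
    have c0 : 0 <= mu * (6 + 3 * mu) / eps.
      by rewrite divr_ge0 ?(ltW eps0) // mulr_ge0 //; lra.
    rewrite /eta ler_pdivrMr ?ltr0n // [leRHS]mulrC -ler_pdivrMr //.
    apply: (le_trans (ltW (archi_boundP c0))); rewrite ler_nat; lia.
  split; first exact: colle_bounded hP.
  apply: opnorm_le => y hy; apply: (@l1le_le _ _ (eta * 1)); last by rewrite mulr1.
  apply: l1le_eq (l1le_matop hE hy) => i.
  by rewrite (matopB (colle_delta R) hP) ?matop_delta //; exact: l1le_l1 hy.
have hB := colle_Linvmx mu_gt0.
exists (matop (Linvmx mu)); split.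
- split; last by case: (colle_bounded hB).
  move=> z hz; have [_ [Bl1 _ _]] := colle_bounded hB.
  split; [exact: Bl1|exact: Lop_matop_Linvmx|move=> y hy Lyz].
  have d0 : (fun j => y j - matop (Linvmx mu) z j) = (fun=> 0).
    have hBz := Bl1 z hz; apply: (Lop_injective mu_gt0).
      have := l1_lin (-1) hBz hy.
      by rewrite (_ : (fun j => _ + _) = (fun j => y j - matop (Linvmx mu) z j)) // funeqE => j; ring.
    by rewrite LopB // Lyz Lop_matop_Linvmx //; apply/funext => j; rewrite subrr.
  by apply/funext => j; have /(congr1 (fun f => f j))/eqP := d0; rewrite subr_eq0 => /eqP.
- move=> eps eps0 eps1; apply: (le_trans (colle_opnorm hB)); rewrite lee_fin.
  apply: (le_trans (Cmu_ge mu)); rewrite ler_pdivlMr ?subr_gt0 //.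
  by have := Cmu_ge mu; nra.
- by move=> m; exact: colle_bounded (colle_Amx mu_gt0 (oA m)).
- have ge0 m : (0 <= opnorm (fun y j => (matop (Amx mu m.*2) y j - matop (Linvmx mu) y j)%R))%E.
    apply: (@le_trans _ _ (l1norm (fun j => matop (Amx mu m.*2) (fun=> 0) j
      - matop (Linvmx mu) (fun=> 0) j))).
      exact: l1norm_ge0.
    apply: ereal_sup_ubound; exists (fun=> 0) => //=.
    by apply/l1leP; apply: l1le_le (l1le0 R) _.
  have le m : (opnorm (fun y j => (matop (Amx mu m.*2) y j - matop (Linvmx mu) y j)%R)
      <= (rate mu m)%:E)%E.
    apply: opnorm_le => y hy; apply: (@l1le_le _ _ (rate mu m * 1)); last by rewrite mulr1.
    apply: l1le_eq (l1le_matop (colle_Amx_sub_Linvmx mu_gt0 m) hy) => i.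
    by rewrite (matopB (colle_Amx mu_gt0 (oA m)) hB) //; exact: l1le_l1 hy.
  apply: (@squeeze_cvge _ _ _ _ (fun=> 0%E) _ (fun m => (rate mu m)%:E)).
  + by apply: nearW => m; rewrite ge0 le.
  + exact: cvg_cst.
  + by apply: cvg_EFin; [exact: nearW|exact: rate_cvg0].
Qed.
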